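(* Let $(K,<)$ be a nonarchimedean ordered field with natural valuation $v$, let $\ell$ be a (not necessarily surjective) strong logarithm on $(K,<)$ which is compatible with $v$, and let $w$ be a coarsening of $v$. Then the following assertions are equivalent: a) $\ell(\mathcal U_w^{>0})=R_w\cap\mathrm{im}(\ell)$; b) $\ell(K^{>0}\setminus R_w)\subset K^{>0}\setminus R_w$; c) $(vK)^{<0}\setminus G_w$ is closed under $\chi$; d) $G_w^{<0}$ is closed under $\chi$-equivalence; e) $\Gamma\setminus\Gamma_w$ is closed under $\zeta$; f) $\Gamma_w$ is closed under $\zeta$-equivalence. If $\ell$ is the inverse of an exponential $f$, then these conditions are also equivalent to each of: g) $a\in R_w\Rightarrow f(a)\in R_w$ for all $a\in K^{>0}\setminus R_v$; h) $va\in G_w\Rightarrow vf(a)\in G_w$ for all $a\in K^{>0}\setminus R_v$; i) $v_Gva\in\Gamma_w\Rightarrow v_Gvf(a)\in\Gamma_w$ for all $a\in K^{>0}\setminus R_v$.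
   Context: Valuations are written additively; $R_w$, $I_w$, $wK$ denote valuation ring, valuation ideal, value group. The natural valuation $v$ of $(K,<)$ sends a nonzero $a$ to its archimedean class, with $va<vb$ iff $|a|>n|b|$ for all $n\in\mathbb N$; $K$ is nonarchimedean iff $v$ is nontrivial. A coarsening of $v$ is a valuation $w$ with $R_w\supseteq R_v$. Put $\mathcal U_w^{>0}=\{a\in K:wa=0,\ a>0\}$ and $G_w=\{va:a\in K,\ wa=0\}$, a convex subgroup of $vK$. An exponential on $(K,<)$ is an isomorphism of ordered groups from $(K,+,0,<)$ onto $(K^{>0},\cdot,1,<)$. A logarithm is an embedding of ordered groups $\ell$ of $(K^{>0},\cdot,1,<)$ in $(K,+,0,<)$, not necessarily surjective. $\ell$ is strong if $va<v\ell a$ for all $a\in K^{>0}\setminus R_v$. $\ell$ is compatible with $w$ if $\ell(\mathcal U_w^{>0})=R_w\cap\mathrm{im}(\ell)$ and $\ell(1+I_w)=I_w\cap\mathrm{im}(\ell)$. For an ordered abelian group $G$, $G^{<0}=\{g\in G:g<0\}$; $v_G$ denotes the natural valuation of $G$, sending $g\neq0$ to its archimedean class, with $v_Gg<v_Gg'$ iff $|g|>n|g'|$ for all $n\in\mathbb N$; $v_GG=v_G(G\setminus\{0\})$. Put $\Gamma=v_GvK$ and $\Gamma_w=v_G(G_w\setminus\{0\})$, a final segment of $\Gamma$. Since $\ell$ is strong and compatible with $v$, the maps $\chi:(vK)^{<0}\to(vK)^{<0}$, $\chi(va)=v\ell a$ for $a\in K^{>0}\setminus R_v$, and $\zeta:\Gamma\to\Gamma$,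 $\zeta(v_Gg)=v_G\chi g$ for $g\in(vK)^{<0}$, are well defined and preserve $\le$. For a monotone map $\varphi$ of a totally ordered set $S$ into itself, $\varphi$-equivalence is the equivalence relation $a\sim_\varphi a'$ iff the convex hulls in $S$ of $\{a\}\cup\{\varphi^n(a):n\in\mathbb N\}$ and $\{a'\}\cup\{\varphi^n(a'):n\in\mathbb N\}$ intersect. A subset is closed under $\varphi$-equivalence if it is a union of equivalence classes of $\sim_\varphi$; it is closed under $\varphi$ if $\varphi$ maps it into itself. *)

(* Defs.v *)
From HB Require Import structures.
From mathcomp Require Import all_boot all_order all_algebra.
From mathcomp Require Import generic_quotient.
From mathcomp Require Import boolp classical_sets.

Set Implicit Arguments.
Unset Strict Implicit.
Unset Printing Implicit Defensive.

Import Order.TTheory GRing.Theory Num.Theory.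
Local Open Scope classical_set_scope.
Local Open Scope ring_scope.
Local Open Scope quotient_scope.

(* Ordered abelian groups.  Totality is an axiom here, rather than inherited
   from Order.Total: the join of Order.Total with GRing.Zmodule would have to be
   declared below Num.RealDomain. *)
HB.mixin Record POrderedZmodule_isOAG G of Num.POrderedZmodule G := {
  oag_le_total : total (<=%O : rel G);
  oag_lerD2l : forall z x y : G, x <= y -> z + x <= z + y
}.

#[short(type="oagType")]
HB.structure Definition OAG :=
  { G of Num.POrderedZmodule G & POrderedZmodule_isOAG G }.

(* Strict weak orders on T, and the totally ordered quotient of T by
   incomparability.  Both natural valuations below are quotient maps of
   this kind. *)
Record weak_order (T : Type) := WeakOrder {
  wlt :> rel T;
  wlt_asym : forall x y, wlt x y -> ~~ wlt y x;
  wlt_negtrans : forall y x z, ~~ wlt x y -> ~~ wlt y z -> ~~ wlt x z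
}.

Section Classes.
Variables (T : choiceType) (r : weak_order T).

Definition incomparable (x y : T) := ~~ r x y && ~~ r y x.

Lemma incomparable_refl : reflexive incomparable.
Proof.
move=> x; rewrite /incomparable andbb; apply/negP => rxx.
by have := wlt_asym rxx; rewrite rxx.
Qed.

Lemma incomparable_sym : symmetric incomparable.
Proof. by move=> x y; rewrite /incomparable andbC. Qed.

Lemma incomparable_trans : transitive incomparable.
Proof.
move=> y x z /andP[xy yx] /andP[yz zy]; apply/andP; split.
  exact: wlt_negtrans yz.
exact: wlt_negtrans yx.
Qed.

Canonical incomparable_equiv :=
  EquivRel incomparable incomparable_refl incomparable_sym incomparable_trans.

Definition classes := {eq_quot incomparable}.
HB.instance Definition _ : EqQuotient _ incomparable classes :=
  EqQuotient.on classes.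
HB.instance Definition _ := Choice.on classes.

Definition class_of (x : T) : classes := \pi_classes x.

Definition class_le (c d : classes) := ~~ r (repr d) (repr c).

Lemma class_ofE x y : (class_of x == class_of y) = incomparable x y.
Proof. by rewrite /class_of eqmodE. Qed.

Lemma repr_incomparable x : incomparable (repr (class_of x)) x.
Proof. by rewrite -class_ofE /class_of reprK. Qed.

Lemma class_leE x y : class_le (class_of x) (class_of y) = ~~ r y x.
Proof.
have /andP[x1 x2] := repr_incomparable x.
have /andP[y1 y2] := repr_incomparable y.
rewrite /class_le; apply/idP/idP => h.
  exact: wlt_negtrans (wlt_negtrans y2 h) x1.
exact: wlt_negtrans (wlt_negtrans y1 h) x2.
Qed.

Lemma class_of_repr c : class_of (repr c) = c.
Proof. by rewrite /class_of reprK. Qed.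

Fact class_le_refl : reflexive class_le.
Proof. by move=> c; have /andP[] := incomparable_refl (repr c). Qed.

Fact class_le_anti : antisymmetric class_le.
Proof.
move=> c d /andP[cd dc]; rewrite -[c]class_of_repr -[d]class_of_repr.
by apply/eqP; rewrite class_ofE; apply/andP.
Qed.

Fact class_le_trans : transitive class_le.
Proof. by move=> d c e cd de; apply: wlt_negtrans cd. Qed.

Fact class_le_total : total class_le.
Proof.
move=> c d; rewrite /class_le orbC; case: (boolP (r (repr c) _)) => //= cd.
exact: wlt_asym cd.
Qed.

HB.instance Definition _ := Order.Le_isPOrder.Build ring_display classes
  class_le_refl class_le_anti class_le_trans.
HB.instance Definition _ := Order.POrder_isTotal.Build ring_display classes
  class_le_total.

Lemma le_class x y : (class_of x <= class_of y) = ~~ r y x.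
Proof. exact: class_leE. Qed.

Lemma lt_class x y : (class_of x < class_of y) = r x y.
Proof. by rewrite ltNge le_class negbK. Qed.

End Classes.

(* Natural valuation of an ordered abelian group. *)
Section GroupNaturalValuation.
Variable G : oagType.
Implicit Types g h : G.

Definition absg g : G := Order.max g (- g).

Definition garch_lt g h := `[< forall n : nat, absg h *+ n < absg g >].

Lemma oag_comparable g h : (g >=< h)%O.
Proof. exact: oag_le_total. Qed.

Lemma oag_ltNge g h : (g < h) = ~~ (h <= g).
Proof. by rewrite comparable_ltNge ?oag_comparable. Qed.

Lemma oag_leD g1 g2 h1 h2 : g1 <= h1 -> g2 <= h2 -> g1 + g2 <= h1 + h2.
Proof.
move=> a b; apply: (@le_trans _ _ (g1 + h2)); first exact: oag_lerD2l.
by rewrite addrC [leRHS]addrC; apply: oag_lerD2l.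
Qed.

Lemma oag_leMn g h n : g <= h -> g *+ n <= h *+ n.
Proof.
by move=> gh; elim: n => [|n IH]; rewrite ?mulr0n// !mulrS oag_leD.
Qed.

Lemma oag_oppr_ge0 g : g <= 0 -> 0 <= - g.
Proof. by move=> /(oag_lerD2l (- g)); rewrite addNr addr0. Qed.

Lemma oag_oppr_le0 g : 0 <= g -> - g <= 0.
Proof. by move=> /(oag_lerD2l (- g)); rewrite addNr addr0. Qed.

Lemma absg_ge0 g : 0 <= absg g.
Proof.
rewrite /absg comparable_le_max ?oag_comparable//.
by have /orP[->//|/oag_oppr_ge0 ->] := oag_le_total 0 g; rewrite orbT.
Qed.

Lemma garch_leP g h :
  reflect (exists n : nat, absg g <= absg h *+ n) (~~ garch_lt g h).
Proof.
apply: (iffP negP) => [gh|[n gh] /asboolP/(_ n)].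
  apply/not_existsP => nh; apply: gh; apply/asboolP => n.
  by rewrite oag_ltNge; apply/negP/nh.
by rewrite oag_ltNge gh.
Qed.

Fact garch_lt_asym g h : garch_lt g h -> ~~ garch_lt h g.
Proof.
by move=> /asboolP/(_ 1%N)/ltW; rewrite mulr1n => hg; apply/garch_leP; exists 1%N.
Qed.

Fact garch_lt_negtrans h g k :
  ~~ garch_lt g h -> ~~ garch_lt h k -> ~~ garch_lt g k.
Proof.
move=> /garch_leP[n gh] /garch_leP[m hk]; apply/garch_leP.
by exists (m * n)%N; rewrite mulrnA (le_trans gh)// oag_leMn.
Qed.

Definition garch_order := WeakOrder garch_lt_asym garch_lt_negtrans.

(* The class of 0, which is the greatest element, plays the role of the value
   of 0; it is excluded from value sets. *)
Definition gvalues := classes garch_order.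
HB.instance Definition _ := Order.Total.on gvalues.

Definition gval g : gvalues := class_of garch_order g.

Lemma gval_lt g h :
  gval g < gval h <-> forall n : nat, absg h *+ n < absg g.
Proof. by rewrite lt_class; split => /asboolP. Qed.

End GroupNaturalValuation.

(* Natural valuation of an ordered field; its values are written additively. *)
Section FieldNaturalValuation.
Variable K : realFieldType.

Definition nonzero := {a : K | a != 0}.
HB.instance Definition _ := SubChoice.on nonzero.
Implicit Types a b : nonzero.

Definition karch_lt a b := `[< forall n : nat, `|val b| *+ n < `|val a| >].

Lemma karch_leP a b :
  reflect (exists n : nat, `|val a| <= `|val b| *+ n) (~~ karch_lt a b).
Proof.
apply: (iffP negP) => [gh|[n gh] /asboolP/(_ n)].
  apply/not_existsP => nh; apply: gh; apply/asboolP => n.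
  by rewrite ltNge; apply/negP/nh.
by rewrite ltNge gh.
Qed.

Fact karch_lt_asym a b : karch_lt a b -> ~~ karch_lt b a.
Proof.
by move=> /asboolP/(_ 1%N)/ltW; rewrite mulr1n => hg; apply/karch_leP; exists 1%N.
Qed.

Fact karch_lt_negtrans b a c :
  ~~ karch_lt a b -> ~~ karch_lt b c -> ~~ karch_lt a c.
Proof.
move=> /karch_leP[n gh] /karch_leP[m hk]; apply/karch_leP.
by exists (m * n)%N; rewrite mulrnA (le_trans gh)// lerMn2r hk orbT.
Qed.

Definition karch_order := WeakOrder karch_lt_asym karch_lt_negtrans.

Definition vgroup := classes karch_order.
HB.instance Definition _ := Order.Total.on vgroup.

Definition nz1 : nonzero := Sub 1 (oner_neq0 K).
Definition nzM a b : nonzero := Sub (val a * val b) (mulf_neq0 (valP a) (valP b)).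
Definition nzV a : nonzero := Sub (val a)^-1 (invr_neq0 (valP a)).

Local Notation cl := (class_of karch_order).

Definition vgroup0 : vgroup := cl nz1.
Definition vgroup_add (c d : vgroup) : vgroup := cl (nzM (repr c) (repr d)).
Definition vgroup_opp (c : vgroup) : vgroup := cl (nzV (repr c)).

Lemma cl_le2 a b c d : (cl a <= cl b) -> (cl c <= cl d) ->
  cl (nzM a c) <= cl (nzM b d).
Proof.
rewrite !le_class => /karch_leP[n ab] /karch_leP[m cd].
apply/karch_leP; exists (n * m)%N; rewrite /= !normrM mulrnA.
by rewrite -mulrnAl -mulrnAr ler_pM.
Qed.

Lemma cl_add a b : vgroup_add (cl a) (cl b) = cl (nzM a b).
Proof. by apply/le_anti/andP; split; apply: cl_le2; rewrite class_of_repr. Qed.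

Fact vgroup_addA : associative vgroup_add.
Proof.
move=> c d e; rewrite -[c]class_of_repr -[d]class_of_repr -[e]class_of_repr.
by rewrite !cl_add; congr cl; apply: val_inj; rewrite /= mulrA.
Qed.

Fact vgroup_addC : commutative vgroup_add.
Proof.
by move=> c d; congr cl; apply: val_inj; rewrite /= mulrC.
Qed.

Fact vgroup_add0 : left_id vgroup0 vgroup_add.
Proof.
move=> c; rewrite -[c]class_of_repr cl_add; congr cl; apply: val_inj.
by rewrite /= mul1r.
Qed.

Fact vgroup_addN : left_inverse vgroup0 vgroup_opp vgroup_add.
Proof.
move=> c; rewrite -{2}[c]class_of_repr cl_add; congr cl; apply: val_inj.
by rewrite /= mulVf// (valP (repr c)).
Qed.

HB.instance Definition _ := GRing.isZmodule.Build vgroup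
  vgroup_addA vgroup_addC vgroup_add0 vgroup_addN.

Fact vgroup_lerD2l (z x y : vgroup) : x <= y -> z + x <= z + y.
Proof.
rewrite -[z]class_of_repr -[x]class_of_repr -[y]class_of_repr => xy.
by rewrite [leLHS]cl_add [leRHS]cl_add cl_le2.
Qed.

HB.instance Definition _ := POrderedZmodule_isOAG.Build vgroup
  (@class_le_total _ karch_order) vgroup_lerD2l.

(* Only meaningful for a != 0. *)
Definition natval_fun (a : K) : vgroup := cl (insubd nz1 a).

Lemma natval_lt (a b : K) : a != 0 -> b != 0 ->
  natval_fun a < natval_fun b <-> forall n : nat, `|b| *+ n < `|a|.
Proof.
move=> a0 b0; rewrite lt_class /= /karch_lt !insubdK//.
by split => /asboolP.
Qed.

Lemma natval_le (a b : K) : a != 0 -> b != 0 ->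
  natval_fun a <= natval_fun b <-> exists n : nat, `|b| <= `|a| *+ n.
Proof.
move=> a0 b0; rewrite le_class /=.
by split => [/karch_leP|h]; last apply/karch_leP; rewrite !insubdK.
Qed.

Lemma natvalM (a b : K) : a != 0 -> b != 0 ->
  natval_fun (a * b) = natval_fun a + natval_fun b.
Proof.
move=> a0 b0; rewrite [RHS]cl_add; congr cl; apply: val_inj.
by rewrite /= !insubdK ?[_ \in _]mulf_neq0.
Qed.

Lemma natvalD (a b : K) : a != 0 -> b != 0 -> a + b != 0 ->
  Order.min (natval_fun a) (natval_fun b) <= natval_fun (a + b).
Proof.
move=> a0 b0 ab0; rewrite ge_min; have [le_ab|le_ba] := leP `|a| `|b|.
  apply/orP; right; apply/natval_le => //; exists 2%N.
  by rewrite (le_trans (ler_normD _ _))// mulr2n lerD2r.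
apply/orP; left; apply/natval_le => //; exists 2%N.
by rewrite (le_trans (ler_normD _ _))// mulr2n lerD2l ltW.
Qed.

End FieldNaturalValuation.

(* Krull valuations.  The value at 0 (conventionally infinity) is left
   unconstrained and never used; the value group is the image of the nonzero
   elements, a subgroup of H.  Order.min is a genuine minimum since the order of
   an oagType is total. *)
Record valuation (K : fieldType) (H : oagType) := Valuation {
  val_fun :> K -> H;
  val_mul : forall a b, a != 0 -> b != 0 ->
    val_fun (a * b) = val_fun a + val_fun b;
  val_add : forall a b, a != 0 -> b != 0 -> a + b != 0 ->
    Order.min (val_fun a) (val_fun b) <= val_fun (a + b)
}.

Definition natval (K : realFieldType) : valuation K (vgroup K) :=
  Valuation (@natvalM K) (@natvalD K).

Section ValuationSets.
Variables (K : realFieldType) (H : oagType) (w : valuation K H).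

Definition val_ring : set K := [set a | a = 0 \/ 0 <= w a].
Definition val_ideal : set K := [set a | a = 0 \/ 0 < w a].
Definition pos_units : set K := [set a | 0 < a /\ w a = 0].

End ValuationSets.

Definition coarsening (K : realFieldType) (H : oagType) (w : valuation K H) :=
  val_ring (natval K) `<=` val_ring w.

(* (K^{>0}, *, 1, <) is handled as a subset of K: a logarithm is a function on
   K of which only the values on positive elements matter. *)
Section ExpLog.
Variable K : realFieldType.
Implicit Types l f : K -> K.

Definition pos : set K := [set a | 0 < a].

Definition is_exponential f :=
  [/\ forall a, 0 < f a,
      {morph f : a b / a + b >-> a * b},
      {mono f : a b / a < b} &
      forall b, 0 < b -> exists a, f a = b].

Definition is_logarithm l :=
  {in Num.pos &, {morph l : a b / a * b >-> a + b}} /\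
  {in Num.pos &, {mono l : a b / a < b}}.

Definition log_image l : set K := l @` pos.

Definition inverse_of l f := {in Num.pos, cancel l f} /\ cancel f l.

Definition strong l := forall a, (pos `\` val_ring (natval K)) a ->
  natval K a < natval K (l a).

(* 1 + I_w consists of positive elements as soon as R_w is convex, in
   particular for coarsenings of the natural valuation. *)
Definition compatible l (H : oagType) (w : valuation K H) :=
  l @` pos_units w = val_ring w `&` log_image l /\
  l @` [set 1 + a | a in val_ideal w] = val_ideal w `&` log_image l.

End ExpLog.

Section ClosedUnder.
Variables (d : Order.disp_t) (T : orderType d) (S : set T) (phi : T -> T).

Definition convex_hull (A : set T) : set T :=
  [set s | S s /\ exists x y, [/\ A x, A y, (x <= s)%O & (s <= y)%O]].

Definition orbit (a : T) : set T := a |` [set iter n phi a | n in setT].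

Definition phi_equiv (a b : T) :=
  convex_hull (orbit a) `&` convex_hull (orbit b) !=set0.

Definition equiv_class (a : T) : set T := [set b | S b /\ phi_equiv a b].

Definition closed_under_equiv (A : set T) :=
  exists2 C : set T, C `<=` S & A = \bigcup_(c in C) equiv_class c.

Definition closed_under (A : set T) := phi @` A `<=` A.

End ClosedUnder.

Section InducedMaps.
Variables (K : realFieldType) (l : K -> K).
Local Notation v := (natval K).

Definition vneg : set (vgroup K) := [set g | g < 0].

Definition Gamma : set (gvalues (vgroup K)) := @gval (vgroup K) @` [set g | g <> 0].

(* chi and zeta are given through chosen representatives: |repr g| is a
   positive element of value g, and - |repr c| is a negative element of
   archimedean class c.  They only matter on vneg and Gamma, where chi_val and
   zeta_gval below show that they do not depend on the choice. *)
Definition chi (g : vgroup K) : vgroup K := v (l `|val (repr g)|).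

Definition zeta (c : gvalues (vgroup K)) : gvalues (vgroup K) :=
  gval (chi (- absg (repr c))).

Section Subgroup.
Variables (H : oagType) (w : valuation K H).

Definition vsubgroup : set (vgroup K) := v @` [set a | a != 0 /\ w a = 0].

Definition vsubgroup_neg : set (vgroup K) := vsubgroup `&` vneg.

Definition Gamma_sub : set (gvalues (vgroup K)) :=
  @gval (vgroup K) @` [set g | vsubgroup g /\ g <> 0].

End Subgroup.

Hypotheses (logl : is_logarithm l) (lv : compatible l v).

Let lM a b : 0 < a -> 0 < b -> l (a * b) = l a + l b.
Proof. by move=> a0 b0; apply: logl.1; rewrite posrE. Qed.

Let l_lt a b : 0 < a -> 0 < b -> (l a < l b) = (a < b).
Proof. by move=> a0 b0; apply: logl.2; rewrite posrE. Qed.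

Let l_le a b : 0 < a -> 0 < b -> a <= b -> l a <= l b.
Proof.
move=> a0 b0; rewrite !leNgt; apply: contra => ab.
by rewrite -l_lt.
Qed.

Let l_inj a b : 0 < a -> 0 < b -> l a = l b -> a = b.
Proof.
move=> a0 b0 e; apply/eqP; rewrite eq_le !leNgt.
by apply/andP; split; apply/negP; rewrite -l_lt// e ltxx.
Qed.

Let l1 : l 1 = 0.
Proof. by apply: (addrI (l 1)); rewrite -lM ?ltr01// mulr1 addr0. Qed.

Let lX a n : 0 < a -> l (a ^+ n) = l a *+ n.
Proof.
move=> a0; elim: n => [|n IH]; first by rewrite expr0 l1.
by rewrite exprS lM ?exprn_gt0// IH mulrS.
Qed.

Let v1 : v 1 = 0.
Proof. by apply: (addrI (v 1)); rewrite -val_mul ?oner_neq0// mulr1 addr0. Qed.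

Lemma val_ring_natvalP a :
  val_ring v a <-> exists n : nat, `|a| <= n%:R.
Proof.
split=> [[->|h]|[n an]]; first by exists 0%N; rewrite normr0.
  have [->|a0] := eqVneq a 0; first by exists 0%N; rewrite normr0.
  by move: h; rewrite -v1 => /natval_le[]//; rewrite ?oner_neq0// => n;
     rewrite normr1; exists n.
have [->|a0] := eqVneq a 0; first by left.
right; rewrite -v1; apply/natval_le; rewrite ?oner_neq0//.
by exists n; rewrite normr1.
Qed.

Lemma log_notin_val_ring a : 0 < a -> ~ val_ring v a ->
  ~ val_ring v (l a) /\ 0 < l a.
Proof.
move=> a0 na; split=> [la|].
  have : (val_ring v `&` log_image l) (l a) by split => //; exists a.
  rewrite -lv.1 => -[b [b0 vb] /l_inj] /(_ b0 a0) ba.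
  by apply: na; right; rewrite -ba vb.
rewrite -l1 l_lt// ltNge; apply/negP => a1; apply: na.
by apply/val_ring_natvalP; exists 1%N; rewrite ger0_norm// ltW.
Qed.

Let l_nat n : (0 < n)%N -> exists m : nat, `|l n%:R| <= m%:R.
Proof.
move=> n0; apply/val_ring_natvalP.
have n0' : (n%:R : K) != 0 by rewrite pnatr_eq0 -lt0n.
suff : (val_ring v `&` log_image l) (l n%:R) by case.
rewrite -lv.1; exists n%:R => //; split; first by rewrite ltr0n.
rewrite -v1; apply/le_anti/andP; split; apply/natval_le => //;
  rewrite ?oner_neq0//.
  exists 1%N; rewrite normr1 mulr1n ger0_norm ?ler0n//.
  by rewrite ler1n.
by exists n; rewrite normr1 ger0_norm ?ler0n.
Qed.

(* If b <= n a^k with a infinitely large then v (l a) <= v (l b). *)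
Let chi_aux a b n k : 0 < a -> ~ val_ring v a -> 0 < b -> ~ val_ring v b ->
  b <= a ^+ k *+ n -> v (l a) <= v (l b).
Proof.
move=> a0 na b0 nb ban.
have [nla la0] := log_notin_val_ring a0 na.
have [nlb lb0] := log_notin_val_ring b0 nb.
have n0 : (0 < n)%N.
  by rewrite lt0n; apply: contraTneq ban => ->; rewrite mulr0n -ltNge.
have [m lnm] := l_nat n0.
apply/natval_le; rewrite ?gt_eqF//; exists (k + m)%N; rewrite !gtr0_norm//.
move: ban; rewrite -mulr_natr => /l_le.
rewrite mulr_gt0 ?exprn_gt0 ?ltr0n// => /(_ b0 isT) /le_trans; apply.
rewrite lM ?exprn_gt0 ?ltr0n// lX// mulrnDr lerD2l.
rewrite (le_trans (ler_norm _))// (le_trans lnm)// lerMn2r; apply/orP; right.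
rewrite leNgt; apply/negP => la1; apply: nla; apply/val_ring_natvalP.
by exists 1%N; rewrite gtr0_norm// ltW.
Qed.

Let repr_val (g : vgroup K) : v `|val (repr g)| = g.
Proof.
have r0 := valP (repr g); rewrite -[RHS](class_of_repr g).
have e : val (insubd (nz1 K) `|val (repr g)|) = `|val (repr g)|.
  by rewrite insubdK// -topredE /= normr_eq0.
apply/eqP; rewrite class_ofE; apply/andP.
by split; apply/karch_leP; exists 1%N; rewrite e normr_id mulr1n.
Qed.

Lemma val_neg_notin a : v a < 0 -> a != 0 -> ~ val_ring v a.
Proof. by move=> va a0 [/eqP|]; [rewrite (negPf a0)|rewrite leNgt va]. Qed.

Lemma notin_val_neg a : ~ val_ring v a -> v a < 0.
Proof. by move=> na; rewrite ltNge; apply/negP => h; apply: na; right. Qed.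

Lemma chi_val a : 0 < a -> ~ val_ring v a -> chi (v a) = v (l a).
Proof.
move=> a0 na; rewrite /chi; set b := `|_|.
have b0 : 0 < b by rewrite normr_gt0; exact: valP (repr (v a)).
have vab : v b = v a by rewrite /b repr_val.
have nb : ~ val_ring v b.
  apply: val_neg_notin; last by rewrite gt_eqF.
  by rewrite vab; exact: notin_val_neg.
have [n abn] : exists n : nat, a <= b *+ n.
  rewrite -{1}(gtr0_norm a0) -(gtr0_norm b0).
  by apply/(natval_le (lt0r_neq0 b0) (lt0r_neq0 a0)); rewrite -[natval_fun a]/(v a) -vab.
have [m bam] : exists m : nat, b <= a *+ m.
  rewrite -{1}(gtr0_norm b0) -(gtr0_norm a0).
  by apply/(natval_le (lt0r_neq0 a0) (lt0r_neq0 b0)); rewrite -[natval_fun a]/(v a) -vab.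
by apply/le_anti/andP; split; [apply: (@chi_aux _ _ n 1)|apply: (@chi_aux _ _ m 1)];
  rewrite ?expr1.
Qed.

Let vX a n : a != 0 -> v (a ^+ n) = v a *+ n.
Proof.
move=> a0; elim: n => [|n IH]; first by rewrite expr0 v1.
by rewrite exprS val_mul ?expf_neq0// IH mulrS.
Qed.

Let chi_aux2 (g h : vgroup K) n : g < 0 -> h < 0 -> g *+ n <= h ->
  chi g <= chi h.
Proof.
rewrite -(repr_val g) -(repr_val h).
set a := `|_|; set b := `|_|; move=> va vb.
have a0 : 0 < a by rewrite normr_gt0; exact: valP (repr g).
have b0 : 0 < b by rewrite normr_gt0; exact: valP (repr h).
have na := val_neg_notin va (lt0r_neq0 a0).
have nb := val_neg_notin vb (lt0r_neq0 b0).
rewrite -vX ?gt_eqF// => ab.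
have [m bam] : exists m : nat, b <= a ^+ n *+ m.
  rewrite -[b]gtr0_norm// -[a ^+ n]gtr0_norm ?exprn_gt0//.
  by apply/natval_le; rewrite ?gt_eqF ?exprn_gt0.
by rewrite !chi_val//; apply: (@chi_aux _ _ m n).
Qed.

Let absg_neg (g : vgroup K) : g < 0 -> absg g = - g.
Proof.
move=> g0; rewrite /absg maxEle (le_trans (ltW g0))//.
exact: oag_oppr_ge0 (ltW g0).
Qed.

Let absg_opp (g : vgroup K) : absg (- g) = absg g.
Proof. by rewrite /absg opprK maxC. Qed.

Lemma zeta_gval (g : vgroup K) : g < 0 -> zeta (gval g) = gval (chi g).
Proof.
move=> g0; rewrite /zeta; set h := repr _.
have /andP[/garch_leP[n hg] /garch_leP[m gh]] := repr_incomparable (garch_order _) g.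
have opp_le (x y : vgroup K) : x <= y -> - y <= - x.
  by move=> /(oag_lerD2l (- x - y)); rewrite subrK addrAC addNr add0r.
have h0 : - absg h < 0.
  rewrite lt_neqAle oag_oppr_le0 ?absg_ge0// andbT; apply/eqP => e.
  move: gh; rewrite -/h -[absg h]opprK e oppr0 mul0rn absg_neg// => /opp_le.
  by rewrite opprK oppr0 leNgt g0.
congr gval; apply/le_anti/andP; split.
  apply: (@chi_aux2 _ _ m) => //.
  by rewrite -[leRHS]opprK -(absg_neg g0) mulNrn opp_le.
apply: (@chi_aux2 _ _ n) => //.
by rewrite -[g]opprK -(absg_neg g0) mulNrn opp_le.
Qed.

End InducedMaps.

Arguments pos K : clear implicits.
Arguments vneg K : clear implicits.
Arguments Gamma K : clear implicits.

(* Main.v *)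
(* The coarsenings w of v correspond to the convex subgroups G_w, and these to
   the final segments Gamma_w: for a > 0 outside R_v, a lies in R_w iff va lies
   in G_w, iff v_G va lies in Gamma_w.  Hence b), c) and e) are the same
   condition read at three levels.  For a) it remains to see that l always maps
   the positive w-units into R_w, which for infinitely large a is strength,
   va < v(la).  Strength also makes chi and zeta increase every element, so a
   final segment is closed under equivalence iff no orbit starting outside it
   ever enters it; this gives d) and f). *)

Require Import Defs.
From HB Require Import structures.
From mathcomp Require Import all_boot all_order all_algebra.
From mathcomp Require Import boolp classical_sets.

Set Implicit Arguments.
Unset Strict Implicit.
Unset Printing Implicit Defensive.

Import Order.TTheory GRing.Theory Num.Theory.
Local Open Scope classical_set_scope.
Local Open Scope ring_scope.


(** * Equivalence classes of a map that moves no element down *)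

Section OrbitEquivalence.
Variables (d : Order.disp_t) (T : orderType d) (S A : set T) (phi : T -> T).
Hypotheses (phiS : forall x, S x -> S (phi x))
  (phi_ge : forall x, S x -> (x <= phi x)%O).

Let iterS n x : S x -> S (iter n phi x).
Proof. by move=> Sx; elim: n => //= n; apply: phiS. Qed.

Let iter_ge n x : S x -> (x <= iter n phi x)%O.
Proof.
by move=> Sx; elim: n => //= n /le_trans; apply; apply/phi_ge/iterS.
Qed.

(** As [phi] moves nothing down, [x] is the least point of its orbit, so only the upper end of the
    hull needs an iterate. *)
Lemma convex_hull_orbit x s : S x ->
  convex_hull S (Defs.orbit phi x) s <->
  [/\ S s, (x <= s)%O & exists n, (s <= iter n phi x)%O].
Proof.
move=> Sx; split=> [[Ss [y [z [oy oz ys sz]]]]|[Ss xs [n sn]]]; last first.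
  by split=> //; exists x, (iter n phi x); split=> //; [left|right; exists n].
split=> //.
  by case: oy ys => [->//|[n _ <-]]; apply: le_trans; apply: iter_ge.
by case: oz sz => [->|[n _ <-]] sz; [exists 0%N|exists n].
Qed.

Hypotheses (AS : A `<=` S)
  (A_final : forall x y, A x -> S y -> (x <= y)%O -> A y).

(** If orbits starting outside [A] stay outside, a hull meeting that of a point of [A] must belong
    to a point of [A]: the common point is in the final segment, hence so is an iterate above it.
    Conversely [x] and [phi x] are always equivalent, so no orbit can step into a union of
    classes. *)
Lemma closed_under_compl_equiv :
  closed_under phi (S `\` A) <-> closed_under_equiv S phi A.
Proof.
split=> [cl|[C CS AE] _ [x [Sx nAx] <-]].
  have iter_cl n y : S y -> ~ A y -> ~ A (iter n phi y).
    move=> Sy nAy; elim: n => //= n IH.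
    suff /cl[] : (phi @` (S `\` A)) (iter n.+1 phi y) by [].
    by exists (iter n phi y) => //; split=> //; apply: iterS.
  (* [A] serves as its own set of class representatives. *)
  exists A => //; apply/seteqP; split=> [x Ax|y [x Ax [Sy]]].
    have Sx := AS Ax; exists x => //; split=> //; exists x.
    by split; apply/convex_hull_orbit => //; split=> //; exists 0%N.
  move=> [s [/(convex_hull_orbit _ (AS Ax))[Ss xs _]]].
  move=> /(convex_hull_orbit _ Sy)[_ _ [n sn]].
  apply: contrapT => nAy; apply: (iter_cl n y Sy nAy).
  exact: A_final (A_final Ax Ss xs) (iterS _ Sy) sn.
split; first exact: phiS.
rewrite {1}AE => -[c Cc [_ [s [sc]]]].
move=> /(convex_hull_orbit _ (phiS Sx))[Ss xs [n sn]].
(* The point shared by the hulls of [c] and [phi x] also lies in the hull of [x], which puts [x] in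
   the class of [c]. *)
apply: nAx; rewrite AE; exists c => //; split=> //; exists s; split=> //.
apply/convex_hull_orbit => //; split=> //; first exact: le_trans (phi_ge Sx) xs.
by exists n.+1; rewrite iterSr.
Qed.

End OrbitEquivalence.

(** * Absolute values and archimedean classes in an ordered abelian group *)

Section OagAbs.
Variable G : oagType.
Implicit Types g h : G.

Lemma oag_lerN2 g h : g <= h -> - h <= - g.
Proof. by move=> /(oag_lerD2l (- g - h)); rewrite subrK addrAC addNr add0r. Qed.

Lemma absg_opp g : absg (- g) = absg g.
Proof.
by rewrite /absg opprK comparable_maxC ?oag_comparable.
Qed.

Lemma gval_opp g : gval (- g) = gval g.
Proof.
by apply/eqP; rewrite class_ofE; apply/andP; split; apply/garch_leP;
  exists 1%N; rewrite absg_opp mulr1n.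
Qed.

Lemma gval_le g h :
  gval g <= gval h <-> exists n : nat, absg h <= absg g *+ n.
Proof. by rewrite le_class; split=> [/garch_leP|?]; last apply/garch_leP. Qed.

Lemma ge_absg_range g h : absg g <= h -> - h <= g /\ g <= h.
Proof.
rewrite /absg comparable_ge_max ?oag_comparable// => /andP[gh Ngh].
by split=> //; rewrite -[g]opprK oag_lerN2.
Qed.

Lemma absg_le0 g : g <= 0 -> absg g = - g.
Proof.
move=> g0; rewrite /absg /Order.max; case: ifPn => //.
rewrite lt_neqAle (le_trans g0 (oag_oppr_ge0 g0)) andbT negbK.
by move=> /eqP.
Qed.

End OagAbs.

(** * Coarsenings, their convex subgroups and final segments *)

Section Coarsening.
Variables (K : realFieldType) (H : oagType) (w : valuation K H).
Local Notation v := (natval K).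
Implicit Types (a b : K) (g h : vgroup K).

Lemma valuation1 (F : fieldType) (L : oagType) (u : valuation F L) : u 1 = 0.
Proof. by apply: (addrI (u 1)); rewrite -val_mul ?oner_neq0// mulr1 addr0. Qed.

Lemma valuationV (F : fieldType) (L : oagType) (u : valuation F L) (a : F) :
  a != 0 -> u a^-1 = - u a.
Proof.
move=> a0; apply: (addrI (u a)).
by rewrite subrr -val_mul ?invr_eq0// mulfV// valuation1.
Qed.

Lemma val_ringN a : val_ring w a -> val_ring w (- a).
Proof.
have wN1 : 0 <= w (-1).
  have e : w (-1) + w (-1) = 0.
    by rewrite -val_mul ?oppr_eq0 ?oner_neq0// mulrNN mulr1 valuation1.
  (* If [w (-1)] were at most 0, adding it to itself would give 0 = 2 [w (-1)] <= [w (-1)]. *)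
  have /orP[//|le0] := oag_le_total 0 (w (-1)).
  by rewrite -e -{3}[w (-1)]addr0 oag_lerD2l.
have [->|a0] := eqVneq a 0; first by rewrite oppr0; left.
move=> [/eqP|wa]; first by rewrite (negPf a0).
right; rewrite -mulN1r val_mul ?oppr_eq0 ?oner_neq0//.
by rewrite -[0]addr0 oag_leD.
Qed.

Lemma valuationX (F : fieldType) (L : oagType) (u : valuation F L) (a : F) n :
  a != 0 -> u (a ^+ n) = u a *+ n.
Proof.
move=> a0; elim: n => [|n IH]; first by rewrite expr0 valuation1.
by rewrite exprS val_mul ?expf_neq0// IH mulrS.
Qed.

Lemma natval_ge1_eq0 a : 1 <= a -> val_ring v a -> v a = 0.
Proof.
move=> a1 Ra; have a0 : 0 < a := lt_le_trans ltr01 a1.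
apply/le_anti/andP; split; last by case: Ra => // /eqP; rewrite gt_eqF.
rewrite -(valuation1 v); apply/natval_le; rewrite ?oner_neq0 ?gt_eqF//.
by exists 1%N; rewrite normr1 gtr0_norm.
Qed.

Lemma natval_repr g : exists2 a, 0 < a & v a = g.
Proof.
have r0 := valP (repr g).
exists `|val (repr g)|; first by rewrite normr_gt0.
rewrite -[RHS](class_of_repr g).
have e : val (insubd (nz1 K) `|val (repr g)|) = `|val (repr g)|.
  by rewrite insubdK// -topredE /= normr_eq0.
apply/eqP; rewrite class_ofE; apply/andP.
by split; apply/karch_leP; exists 1%N; rewrite e normr_id mulr1n.
Qed.

Hypothesis w_coarse : coarsening w.

(** The quotient [b / a] lies in R_v, hence in R_w. Thus [w] factors through [v] by an
    order-preserving map, the source of all that follows about G_w. *)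
Lemma coarsening_le a b : a != 0 -> b != 0 -> v a <= v b -> w a <= w b.
Proof.
move=> a0 b0 /(natval_le a0 b0)[n ban].
have /w_coarse[/eqP|ge0] : val_ring v (b / a).
  apply/val_ring_natvalP; exists n.
  by rewrite normf_div ler_pdivrMr ?normr_gt0// mulr_natl.
  by rewrite mulf_eq0 invr_eq0 (negPf a0) (negPf b0).
rewrite -[b](divfK a0) val_mul// ?mulf_neq0 ?invr_eq0//.
by rewrite addrC -{1}[w a]addr0; exact: oag_lerD2l.
Qed.

(** Two elements with the same [v]-value have the same [w]-value, by monotonicity in both
    directions, so the choice of witness does not matter. *)
Lemma vsubgroupE a : a != 0 -> vsubgroup w (v a) <-> w a = 0.
Proof.
move=> a0; split=> [[b [b0 wb] vba]|wa]; last by exists a.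
by apply/le_anti; rewrite -wb !coarsening_le// vba.
Qed.

Lemma vsubgroupN g : vsubgroup w g -> vsubgroup w (- g).
Proof.
move=> [a [a0 wa] <-]; exists a^-1; last by rewrite valuationV.
by rewrite /= invr_eq0 valuationV// wa oppr0.
Qed.

Lemma vsubgroupMn g n : vsubgroup w g -> vsubgroup w (g *+ n).
Proof.
move=> [a [a0 wa] <-]; exists (a ^+ n); last by rewrite valuationX.
by split; rewrite ?expf_neq0// valuationX// wa mul0rn.
Qed.

Lemma vsubgroup_abs g : vsubgroup w g -> vsubgroup w (absg g).
Proof. by rewrite /absg /Order.max; case: ifP => // _ /vsubgroupN. Qed.

Lemma vsubgroup0 : vsubgroup w 0.
Proof. by exists 1; [rewrite /= oner_neq0|]; rewrite !valuation1. Qed.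

Lemma vsubgroup_convex g h k :
  vsubgroup w g -> vsubgroup w k -> g <= h -> h <= k -> vsubgroup w h.
Proof.
move=> [a [a0 wa] <-] [c [c0 wc] <-].
have [b b0 <-] := natval_repr h => ab bc.
apply/vsubgroupE; rewrite ?gt_eqF//; apply/le_anti/andP; split.
  by rewrite -wc coarsening_le// gt_eqF.
by rewrite -wa coarsening_le// gt_eqF.
Qed.

(** An element in the class of some [h] in G_w lies between two multiples of [absg h], and G_w is
    convex. *)
Lemma Gamma_subP g : g <> 0 -> Gamma_sub w (gval g) <-> vsubgroup w g.
Proof.
move=> g0; split=> [[h [Gh h0] hg]|Gg]; last by exists g.
have /gval_le[n ghn] : gval h <= gval g by rewrite hg.
have Ghn : vsubgroup w (absg h *+ n) by apply/vsubgroupMn/vsubgroup_abs.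
have [lo up] := ge_absg_range ghn.
exact: vsubgroup_convex (vsubgroupN Ghn) Ghn lo up.
Qed.

(** Since [v a] < 0, monotonicity forces [w a] <= 0, so [w a] is nonnegative only when it
    vanishes. *)
Lemma val_ring_pos a : 0 < a -> ~ val_ring v a ->
  val_ring w a <-> vsubgroup w (v a).
Proof.
move=> a0 na; have a_neq0 := lt0r_neq0 a0; rewrite vsubgroupE//.
split=> [[/eqP|wa]|wa]; [by rewrite (negPf a_neq0)| |by right; rewrite wa].
apply/le_anti; rewrite wa andbT -(valuation1 w) coarsening_le ?oner_neq0//.
by rewrite valuation1 ltW// notin_val_neg.
Qed.

Lemma Gamma_neg c : Gamma K c -> exists2 g, g < 0 & c = gval g.
Proof.
move=> [g g0 <-]; case: (ltgtP g 0) => [?|gt0|//]; first by exists g.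
exists (- g); last by rewrite gval_opp.
rewrite lt_neqAle oag_oppr_le0 ?ltW// andbT oppr_eq0.
exact/eqP.
Qed.

End Coarsening.

(** * The logarithm and its induced maps on the value group and on its archimedean classes *)

Section Logarithm.
Variables (K : realFieldType) (l : K -> K) (H : oagType) (w : valuation K H).
Local Notation v := (natval K).
Hypotheses (l_log : is_logarithm l) (l_strong : strong l)
  (l_compat : compatible l v) (w_coarse : coarsening w).
Implicit Types (a b : K) (g h : vgroup K).

Lemma logM a b : 0 < a -> 0 < b -> l (a * b) = l a + l b.
Proof. by move=> a0 b0; apply: l_log.1; rewrite posrE. Qed.

Lemma log_lt a b : 0 < a -> 0 < b -> (l a < l b) = (a < b).
Proof. by move=> a0 b0; apply: l_log.2; rewrite posrE. Qed.

Lemma log_inj a b : 0 < a -> 0 < b -> l a = l b -> a = b.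
Proof.
move=> a0 b0 e; apply/eqP; rewrite eq_le !leNgt.
by apply/andP; split; apply/negP; rewrite -log_lt// e ltxx.
Qed.

Lemma log1 : l 1 = 0.
Proof. by apply: (addrI (l 1)); rewrite -logM ?ltr01// mulr1 addr0. Qed.

Lemma logV a : 0 < a -> l a^-1 = - l a.
Proof.
move=> a0; apply: (addrI (l a)).
by rewrite subrr -logM ?invr_gt0// mulfV ?gt_eqF// log1.
Qed.

Lemma vneg_repr g : g < 0 ->
  exists a, [/\ 0 < a, ~ val_ring v a & v a = g].
Proof.
have [a a0 <-] := natval_repr g => va0; exists a; split=> //.
by apply: val_neg_notin; rewrite ?gt_eqF.
Qed.

Lemma chi_vneg g : g < 0 -> chi l g < 0.
Proof.
move=> /vneg_repr[a [a0 na <-]].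
have [nla _] := log_notin_val_ring l_log l_compat a0 na.
by rewrite chi_val// notin_val_neg.
Qed.

Lemma chi_gt g : g < 0 -> g < chi l g.
Proof.
by move=> /vneg_repr[a [a0 na <-]]; rewrite chi_val//; apply: l_strong.
Qed.

Lemma log_notin a : 0 < a -> ~ val_ring w a ->
  [/\ ~ val_ring v a, 0 < l a & ~ val_ring v (l a)].
Proof.
move=> a0 na; have nva : ~ val_ring v a by move=> /w_coarse.
by have [] := log_notin_val_ring l_log l_compat a0 nva.
Qed.

(** This inclusion in a) holds for every coarsening. For infinitely large [a], strength gives 0 =
    [w a] <= [w (l a)]; a finite [a] >= 1 is a [v]-unit, and compatibility with [v] puts [l a] in
    R_v. *)
Lemma val_ring_log a : 0 < a -> w a = 0 -> val_ring w (l a).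
Proof.
(* Inverting [a] only changes the sign of [l a]. *)
wlog a1 : a / 1 <= a => [wlog_a|] a0 wa.
  have [/wlog_a|/ltW a1] := leP 1 a; first exact.
  have := wlog_a a^-1; rewrite invf_ge1// invr_gt0 logV// valuationV ?gt_eqF//.
  by rewrite wa oppr0 => /(_ a1 a0 erefl)/val_ringN; rewrite opprK.
have [Ra|na] := pselect (val_ring v a); last first.
  right; rewrite -wa; have [_ la0] := log_notin_val_ring l_log l_compat a0 na.
  by apply: coarsening_le; rewrite ?gt_eqF// ltW// l_strong.
apply: w_coarse; suff : (val_ring v `&` log_image l) (l a) by case.
rewrite -l_compat.1; exists a => //; split=> //.
exact: natval_ge1_eq0.
Qed.

(** From a) to b), injectivity of [l] makes [a] a [w]-unit once [l a] is in R_w. Backwards, b) says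
    that [l a] in R_w forces [a] in R_w; used for both [a] and its inverse, this gives [w a] = 0. *)
Lemma log_units_compl :
  l @` pos_units w = val_ring w `&` log_image l <->
  l @` (pos K `\` val_ring w) `<=` pos K `\` val_ring w.
Proof.
split=> [units _ [a [a0 na] <-]|compl].
  have [_ la0 _] := log_notin a0 na; split=> // Rla.
  have : (val_ring w `&` log_image l) (l a) by split=> //; exists a.
  rewrite -units => -[b [b0 wb] /log_inj ba].
  by apply: na; right; rewrite -ba// wb.
have log_ring a : 0 < a -> val_ring w (l a) -> val_ring w a.
  move=> a0 Rla; apply: contrapT => na.
  suff /compl[] : (l @` (pos K `\` val_ring w)) (l a) by [].
  by exists a.
apply/seteqP; split=> [_ [a [a0 wa] <-]|y [Ry [a a0 ay]]].
  by split; [exact: val_ring_log|exists a].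
have a_neq0 := lt0r_neq0 a0.
rewrite -ay in Ry *; exists a => //; split=> //.
apply/le_anti/andP; split; last first.
  by have [/eqP|//] := log_ring _ a0 Ry; rewrite (negPf a_neq0).
have /log_ring : 0 < a^-1 by rewrite invr_gt0.
rewrite logV// => /(_ (val_ringN Ry)) [/eqP|].
  by rewrite invr_eq0 (negPf a_neq0).
by rewrite valuationV// => /oag_oppr_le0; rewrite opprK.
Qed.

(** Compatibility with [v] keeps [l a] infinitely large when [a] is, so [val_ring_pos] translates
    membership for both. *)
Lemma log_compl_chi :
  l @` (pos K `\` val_ring w) `<=` pos K `\` val_ring w <->
  closed_under (chi l) (vneg K `\` vsubgroup w).
Proof.
split=> [compl _ [_ [/vneg_repr[a [a0 na <-]] nGa] <-]|cl _ [a [a0 na] <-]].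
  have [nla la0] := log_notin_val_ring l_log l_compat a0 na.
  rewrite chi_val//; split; first exact: notin_val_neg.
  rewrite -val_ring_pos//.
  suff /compl[] : (l @` (pos K `\` val_ring w)) (l a) by [].
  by exists a => //; split=> //; rewrite val_ring_pos.
have [nva la0 nla] := log_notin a0 na; split=> //.
rewrite val_ring_pos// -chi_val//.
suff /cl[] : (chi l @` (vneg K `\` vsubgroup w)) (chi l (v a)) by [].
by exists (v a) => //; split; [exact: notin_val_neg|rewrite -val_ring_pos].
Qed.

(** Every class in Gamma has a negative representative, and on these [zeta] is induced by [chi]. *)
Lemma chi_zeta :
  closed_under (chi l) (vneg K `\` vsubgroup w) <->
  closed_under (zeta l) (Gamma K `\` Gamma_sub w).
Proof.
have neg0 g : g < 0 -> g <> 0 by move=> /lt_eqF/eqP.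
split=> [cl _ [_ [/Gamma_neg[g g0 ->] nGg] <-]|cl _ [g [g0 nGg] <-]];
  have := chi_vneg g0 => cg0.
  rewrite zeta_gval//; split; first by exists (chi l g) => //; exact: neg0.
  rewrite Gamma_subP; [|by []|exact: neg0].
  suff /cl[] : (chi l @` (vneg K `\` vsubgroup w)) (chi l g) by [].
  exists g => //; split=> // Gg.
  by apply: nGg; apply/Gamma_subP => //; exact: neg0.
split=> // Gcg.
suff /cl[_] : (zeta l @` (Gamma K `\` Gamma_sub w)) (gval (chi l g)).
  by apply; apply/Gamma_subP => //; exact: neg0.
exists (gval g); last by rewrite zeta_gval.
split; first by exists g => //; exact: neg0.
by rewrite Gamma_subP//; exact: neg0.
Qed.

Lemma chi_equiv :
  closed_under (chi l) (vneg K `\` vsubgroup w) <->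
  closed_under_equiv (vneg K) (chi l) (vsubgroup_neg w).
Proof.
(* The orbit lemma needs a subset of [vneg K]; G_w^{<0} is final there because G_w is convex and
   contains 0. *)
have -> : vneg K `\` vsubgroup w = vneg K `\` vsubgroup_neg w.
  apply/seteqP; split=> g [g0 nGg]; split=> //; first by case.
  by move=> Gg; apply: nGg.
apply: closed_under_compl_equiv => [g|g /chi_gt/ltW//|g []//|g h].
  exact: chi_vneg.
move=> [Gg _] h0 gh; split=> //.
exact: vsubgroup_convex Gg (vsubgroup0 w) gh (ltW h0).
Qed.

(** From g < chi g < 0 one gets |chi g| <= |g|, so [zeta] increases classes, though perhaps only
    weakly. *)
Lemma zeta_equiv :
  closed_under (zeta l) (Gamma K `\` Gamma_sub w) <->
  closed_under_equiv (Gamma K) (zeta l) (Gamma_sub w).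
Proof.
apply: closed_under_compl_equiv => [c|c|c [g [_ g0] <-]|c d].
- move=> /Gamma_neg[g g0 ->]; rewrite zeta_gval//.
  by exists (chi l g) => //=; apply/eqP; rewrite lt_eqF// chi_vneg.
- move=> /Gamma_neg[g g0 ->]; rewrite zeta_gval//; apply/gval_le; exists 1%N.
  rewrite (absg_le0 (ltW g0)) (absg_le0 (ltW (chi_vneg g0))) mulr1n.
  exact/oag_lerN2/ltW/chi_gt.
- by exists g.
- move=> [g [Gg g0] <-] [h h0 <-] /gval_le[n hgn]; exists h => //; split=> //.
  have Ggn : vsubgroup w (absg g *+ n) by apply/vsubgroupMn/vsubgroup_abs.
  have [lo up] := ge_absg_range hgn.
  exact: vsubgroup_convex (vsubgroupN Ggn) Ggn lo up.
Qed.

End Logarithm.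

(** * Closing the two cycles of implications *)

Theorem theorem12 (K : realFieldType) (l : K -> K)
    (H : oagType) (w : valuation K H)
    (K_nonarch : ~ Num.archimedean_axiom K)
    (l_log : is_logarithm l) (l_strong : strong l)
    (l_compat : compatible l (natval K))
    (w_coarse : coarsening w) :
  [<-> l @` pos_units w = val_ring w `&` log_image l;
       l @` (pos K `\` val_ring w) `<=` pos K `\` val_ring w;
       closed_under (chi l) (vneg K `\` vsubgroup w);
       closed_under_equiv (vneg K) (chi l) (vsubgroup_neg w);
       closed_under (zeta l) (Gamma K `\` Gamma_sub w);
       closed_under_equiv (Gamma K) (zeta l) (Gamma_sub w)]
  /\
  forall f : K -> K, is_exponential f -> inverse_of l f ->
  [<-> l @` pos_units w = val_ring w `&` log_image l;
       forall a : K, (pos K `\` val_ring (natval K)) a ->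
         val_ring w a -> val_ring w (f a);
       forall a : K, (pos K `\` val_ring (natval K)) a ->
         vsubgroup w (natval K a) -> vsubgroup w (natval K (f a));
       forall a : K, (pos K `\` val_ring (natval K)) a ->
         Gamma_sub w (gval (natval K a)) ->
         Gamma_sub w (gval (natval K (f a)))].
Proof.
have ab := log_units_compl l_log l_strong l_compat w_coarse.
have bc := log_compl_chi l_log l_compat w_coarse.
have cd := chi_equiv l_log l_strong l_compat w_coarse.
have ce := chi_zeta l_log l_compat w_coarse.
have ef := zeta_equiv l_log l_strong l_compat w_coarse.
split=> [|f [f_pos fD f_lt _] [lK fK]].
  tfae.
  - by move=> /ab.
  - by move=> /bc.
  - by move=> /cd.
  - by move=> /cd /ce.
  - by move=> /ef.
  - by move=> /ef /ce /bc /ab.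
have f_ge1 a : 0 < a -> 1 <= f a.
  move=> a0; rewrite -(lK 1) ?posrE ?ltr01// (log1 l_log).
  by rewrite ltW// f_lt.
(* Here [val_ring_log] is used with [v] as its own coarsening: a finite [f a] >= 1 is a [v]-unit, so
   its logarithm [a] would be finite. *)
have nfa a : 0 < a -> ~ val_ring (natval K) a -> ~ val_ring (natval K) (f a).
  move=> a0 na Rfa; apply: na; rewrite -(fK a).
  apply: (val_ring_log l_log l_strong l_compat) => //.
  exact: natval_ge1_eq0 (f_ge1 a a0) Rfa.
have v0 a : ~ val_ring (natval K) a -> natval K a <> 0.
  by move=> na va; apply: na; right; rewrite va.
tfae.
- move=> units a [a0 na] Ra.
  have : (val_ring w `&` log_image l) a.
    by split=> //; exists (f a) => //; exact: f_pos.
  rewrite -units => -[b [b0 wb] <-].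
  by rewrite lK ?posrE//; right; rewrite wb.
- move=> ring a [a0 na]; rewrite -!val_ring_pos//; last exact: nfa.
  exact: ring.
- move=> sub a [a0 na] /Gamma_subP.
  move=> /(_ w_coarse (v0 _ na)) Ga.
  by apply/Gamma_subP => //; [exact/v0/nfa|exact: sub].
(* The way back from i) to a) goes through b): i) is applied to [l a], whose image under [f] is
   [a]. *)
- move=> sub; apply/ab => _ [a [a0 na] <-].
  have [nva la0 nla] := log_notin l_log l_compat w_coarse a0 na; split=> //.
  rewrite val_ring_pos// => Gla; apply: na; apply/val_ring_pos => //.
  apply/Gamma_subP => //; first exact: v0.
  rewrite -(lK a) ?posrE//; apply: sub => //.
  by apply/Gamma_subP => //; exact: v0.
Qed.
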